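(* Let $G$ be a finite simple bipartite graph with a perfect matching. Then $gf(G)\geq Af(G)$.
   Context: For a perfect matching $M$ of $G$, an anti-forcing set of $M$ is a subset $S\subseteq E(G)\setminus M$ such that $G-S$ (delete the edges of $S$) has a unique perfect matching; $af(G,M)$ is its minimum size and $Af(G)=\max_M af(G,M)$ over all perfect matchings $M$ of $G$. A global forcing set of $G$ is an edge subset $S$ such that no two distinct perfect matchings $M_1,M_2$ of $G$ satisfy $M_1\cap S=M_2\cap S$; $gf(G)$ is the minimum size of a global forcing set. *)

(* Defs.v *)
From mathcomp Require Import all_boot.

Set Implicit Arguments.
Unset Strict Implicit.
Unset Printing Implicit Defensive.

(* A finite simple graph is a symmetric irreflexive e : rel V on a
   finType V; its edges are the two-element sets [set x; y] with e x y. *)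
Section PerfectMatchings.

Variable V : finType.
Implicit Types (e : rel V) (M S : {set {set V}}).

Definition bipartite e : Prop :=
  exists A : {set V}, forall x y, e x y -> (x \in A) != (y \in A).

Definition edges e : {set {set V}} :=
  [set f : {set V} | [exists x, exists y, e x y && (f == [set x; y])]].

Definition del_edges e S : rel V :=
  [rel x y | e x y && ([set x; y] \notin S)].

Definition perfect_matching e M : bool :=
  (M \subset edges e) && [forall v : V, #|[set f in M | v \in f]| == 1].

Definition unique_perfect_matching e : bool :=
  #|[set M | perfect_matching e M]| == 1.

Definition anti_forcing e M S : bool :=
  (S \subset edges e :\: M) && unique_perfect_matching (del_edges e S).

(* The initial value edges e :\: M is itself an anti-forcing set when M is a
   perfect matching (anti_forcing_all below), so this is the true minimum. *)
Definition af e M : nat :=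
  #|[arg min_(S < edges e :\: M | anti_forcing e M S) #|S| ]|.

Definition Af e : nat := \max_(M | perfect_matching e M) af e M.

Definition global_forcing e S : bool :=
  (S \subset edges e) &&
  ~~ [exists M1, exists M2,
       [&& perfect_matching e M1, perfect_matching e M2, M1 != M2
         & M1 :&: S == M2 :&: S]].

(* edges e is always a global forcing set (global_forcing_all below). *)
Definition gf e : nat :=
  #|[arg min_(S < edges e | global_forcing e S) #|S| ]|.

Lemma edges_del e S : edges (del_edges e S) = edges e :\: S.
Proof.
apply/setP=> f; rewrite !inE; apply/existsP/andP.
  case=> x /existsP[y /andP[/andP[exy nS] /eqP ->]]; split=> //.
  by apply/existsP; exists x; apply/existsP; exists y; apply/andP.
case=> nS /existsP[x /existsP[y /andP[exy /eqP fE]]].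
by exists x; apply/existsP; exists y; apply/andP; split; [apply/andP; rewrite -fE | apply/eqP].
Qed.

Lemma edge_neq0 e f : f \in edges e -> exists v, v \in f.
Proof.
rewrite inE => /existsP[x /existsP[y /andP[_ /eqP ->]]].
by exists x; rewrite set21.
Qed.

Lemma perfect_matching_sub_eq e M N :
  perfect_matching e M -> perfect_matching e N -> N \subset M -> N = M.
Proof.
move=> /andP[ME /forallP cM] /andP[_ /forallP cN] NM; apply/eqP.
rewrite eqEsubset NM; apply/subsetP=> f fM.
have [v vf] := edge_neq0 (subsetP ME f fM).
have s : [set f in N | v \in f] \subset [set f in M | v \in f].
  by apply/subsetP=> g; rewrite !inE => /andP[/(subsetP NM) -> ->].
have /eqP E : [set f in N | v \in f] == [set f in M | v \in f].
  by rewrite eqEcard s (eqP (cM v)) (eqP (cN v)).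
have : f \in [set f in M | v \in f] by rewrite inE fM vf.
by rewrite -E inE => /andP[].
Qed.

Lemma anti_forcing_all e M :
  perfect_matching e M -> anti_forcing e M (edges e :\: M).
Proof.
move=> pM; have /andP[ME cM] := pM.
have E : edges (del_edges e (edges e :\: M)) = M.
  by rewrite edges_del setDDr setDv set0U; apply/setIidPr.
have p' : perfect_matching (del_edges e (edges e :\: M)) M.
  by rewrite /perfect_matching E subxx.
rewrite /anti_forcing subxx /=; apply/cards1P; exists M.
apply/setP=> N; rewrite !inE; apply/idP/eqP => [pN|-> //].
apply: (perfect_matching_sub_eq p' pN); by case/andP: pN; rewrite E.
Qed.

Lemma global_forcing_all e : global_forcing e (edges e).
Proof.
rewrite /global_forcing subxx /=; apply/existsPn=> M1; apply/existsPn=> M2.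
apply/and4P=> -[/andP[s1 _] /andP[s2 _] /negP n].
by rewrite (setIidPl s1) (setIidPl s2).
Qed.

Lemma afP e M : perfect_matching e M ->
  (exists2 S, anti_forcing e M S & #|S| = af e M) /\
  (forall S, anti_forcing e M S -> af e M <= #|S|).
Proof.
move=> pM; rewrite /af; case: arg_minnP; first exact: anti_forcing_all.
by move=> S aS mS; split=> //; exists S.
Qed.

Lemma gfP e :
  (exists2 S, global_forcing e S & #|S| = gf e) /\
  (forall S, global_forcing e S -> gf e <= #|S|).
Proof.
rewrite /gf; case: arg_minnP; first exact: global_forcing_all.
by move=> S aS mS; split=> //; exists S.
Qed.

End PerfectMatchings.

(* Main.v *)
(* Let S be a global forcing set and M a perfect matching. On one side of the
   bipartition there is a vertex b with at most one incident edge outside S (see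
   [almost_all_in_S]). Put all edges at b other than its M-edge into the
   anti-forcing set, which costs no more than the edges of S at b, delete b and
   its M-partner, and repeat. Contracting the edges of M turns perfect matchings
   into permutations [s] of the side [A], with [r x (s x)] meaning that [x] is
   adjacent to the M-partner of [s x]; M itself is the identity and deleting
   matched pairs shrinks the support. *)

Require Import Defs.
From mathcomp Require Import all_boot all_fingroup.

Set Implicit Arguments.
Unset Strict Implicit.
Unset Printing Implicit Defensive.

(** * Nonempty sets that a function maps onto themselves *)

Section StableSubset.

Variables (T : finType) (h : T -> T).

(** A smallest nonempty stable subset works: its image is again nonempty and stable, hence cannot be
    smaller. On such a finite [C] the map [h] is a bijection, so [C] serves as the cycle along which
    a permutation is redirected. *)
Lemma stable_subset_exists (A : {set T}) :
  A != set0 -> h @: A \subset A ->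
  exists C : {set T}, [/\ C \subset A, C != set0 & h @: C = C].
Proof.
move=> A0 hA.
pose P (C : {set T}) := [&& C \subset A, C != set0 & h @: C \subset C].
have PA : P A by rewrite /P subxx A0.
case: (arg_minnP (fun C : {set T} => #|C|) PA) => C /and3P[CA C0 hC] minC.
exists C; split=> //; apply/eqP; rewrite eqEcard hC; apply: minC.
rewrite /P (subset_trans hC CA) imsetS // andbT.
by have [x xC] := set0Pn _ C0; apply/set0Pn; exists (h x); rewrite imset_f.
Qed.

End StableSubset.

(** * Permutations inside a reflexive relation, and feedback arc sets *)

Section PermutationsInRelation.

Variables (T : finType) (r : rel T) (S : {set T * T}).
Hypothesis r_refl : reflexive r.

(** Permutations supported in [A] stand for the perfect matchings that agree with the fixed one off
    [A], so the property passes to subsets of [A]. *)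
Definition globally_forces (A : {set T}) : Prop :=
  forall s t : {perm T}, perm_on A s -> perm_on A t ->
    (forall x, r x (s x)) -> (forall x, r x (t x)) ->
    (forall x y, (x, y) \in S -> (s x == y) = (t x == y)) -> s = t.

(* Take [s] meeting [S] least. If every point of [A] had a second choice [g]
   outside [S], redirecting [s] to [g] along a cycle of [s^-1 o g] would give
   another permutation with the same trace on [S]. *)
Lemma almost_all_in_S (A : {set T}) : A != set0 -> globally_forces A ->
  exists b c, [/\ b \in A, c \in A, r b c &
    forall y, y \in A -> r b y -> y != c -> (b, y) \in S].
Proof.
move=> A0 gA.
pose P (s : {perm T}) := perm_on A s && [forall x, r x (s x)].
have P1 : P 1%g.
  by rewrite /P perm_on1; apply/forallP=> x; rewrite perm1.
pose tr (s : {perm T}) := [set x | (x, s x) \in S].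
case: (arg_minnP (fun s => #|tr s|) P1) => s /andP[sA /forallP rs] mins.
case: (pickP (fun b => (b \in A) &&
   [forall y, (y \in A) && r b y && (y != s b) ==> ((b, y) \in S)])).
  move=> b /andP[bA /forallP H]; exists b, (s b); split=> //.
    by rewrite (perm_closed _ sA).
  by move=> y yA rby ny; move: (H y); rewrite yA rby ny.
move=> noB.
(* The default [b] is never reached on [A]: [noB] makes the pick succeed there. *)
pose g b := odflt b [pick y | [&& y \in A, r b y, y != s b & (b, y) \notin S]].
have gP b : b \in A -> [&& g b \in A, r b (g b), g b != s b & (b, g b) \notin S].
  move=> bA; rewrite /g; case: pickP => //= no.
  have /negP[] := negbT (noB b); rewrite bA; apply/forallP=> y.
  by apply/implyP=> /andP[/andP[yA ry] ny]; move: (no y); rewrite yA ry ny /= => /negbFE.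
pose h b := (s^-1)%g (g b).
have hA : h @: A \subset A.
  apply/subsetP=> _ /imsetP[b bA ->]; have /and4P[gbA _ _ _] := gP b bA.
  by rewrite /h (perm_closed _ (perm_onV sA)).
have [C [CA C0 hC]] := stable_subset_exists A0 hA.
have h_inj : {in C &, injective h} by apply/imset_injP; rewrite hC.
pose f x := if x \in C then g x else s x.
have shK x : s (h x) = g x by rewrite /h permKV.
(* Since [h] maps [C] onto itself, the values of [g] on [C] are [s]-images of points of [C]; they
   cannot clash with [s] outside [C]. *)
have f_mix x y : x \in C -> y \notin C -> g x <> s y.
  move=> xC yC; rewrite -shK => /perm_inj E.
  by move: yC; rewrite -E -hC imset_f.
have f_inj : injective f.
  move=> x y; rewrite /f; case: ifPn => xC; case: ifPn => yC.
  - by rewrite -!shK => /perm_inj /h_inj; apply.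
  - by move/f_mix; case.
  - by move/esym/f_mix; case.
  - by move/perm_inj.
pose t := perm f_inj.
have tE x : t x = if x \in C then g x else s x by rewrite permE.
have tA : perm_on A t.
  apply/subsetP=> x; rewrite inE; apply: contraR => xA.
  by rewrite tE (contraNF (subsetP CA x) xA) (out_perm sA).
have rt x : r x (t x).
  by rewrite tE; case: ifPn => // /(subsetP CA) /gP /and4P[].
have tr_t : tr t \subset tr s.
  apply/subsetP=> x; rewrite !inE tE; case: ifPn => // /(subsetP CA) /gP.
  by case/and4P=> _ _ _ /negPf->.
(* Redirected points leave the trace, and the trace of [s] has least size. Hence no point of [C] was
   in it, and on [C] neither [s] nor [t] uses a pair of [S]. *)
have tr_eq : tr t = tr s.
  apply/eqP; rewrite eqEcard tr_t mins // /P tA; exact/forallP.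
have E : s = t.
  apply: gA => // x y xyS; rewrite tE; case: ifPn => // xC.
  have /and4P[_ _ _ gS] := gP x (subsetP CA x xC).
  have : x \notin tr t by rewrite inE tE xC.
  rewrite tr_eq inE => sS.
  have ns (z : T) : (x, z) \notin S -> (z == y) = false.
    by apply: contraNF => /eqP ->.
  by rewrite !ns.
have [x xC] := set0Pn _ C0.
have /and4P[_ _ /eqP gs _] := gP x (subsetP CA x xC).
by case: gs; rewrite E tE xC.
Qed.

(** Seen as a digraph on [A], [r] without loops loses all its directed cycles when [F] is removed.
    By induction on [#|A|], [F] collects every non-loop pair from [b] into [A]; a permutation
    avoiding these fixes [b], so it lives on [A :\ b]. *)
Lemma feedback_set (A : {set T}) : globally_forces A ->
  exists F : {set T * T},
    [/\ forall x y, (x, y) \in F -> [&& x \in A, y \in A, r x y & x != y],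
        #|F| <= #|S :&: setX A A| &
        forall s : {perm T}, perm_on A s ->
          (forall x, r x (s x) && ((x, s x) \notin F)) -> s = 1%g].
Proof.
have [n] := ubnP #|A|; elim: n A => // n IHn A; rewrite ltnS => An gA.
have [->|A0] := eqVneq A set0.
  exists set0; split=> [x y||s sA _]; rewrite ?inE ?cards0 //.
  by apply/permP=> x; rewrite perm1 (out_perm sA) ?inE.
have [b [c [bA cA rbc Hb]]] := almost_all_in_S A0 gA.
have DA : A :\ b \subset A by rewrite subsetDl.
have [||F' [F'A F'S F'1]] := IHn (A :\ b).
- by move: An; rewrite (cardsD1 b) bA.
- by move=> s t sD tD; apply: gA; apply: subset_trans DA.
pose Y := [set y in A | r b y].
exists (F' :|: pair b @: (Y :\ b)); split.
- move=> x y; rewrite inE => /orP[/F'A|].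
    by rewrite !inE => /and4P[/andP[_ ->] /andP[_ ->] -> ->].
  by case/imsetP=> z; rewrite !inE => /and3P[zb zA rz] [-> ->]; rewrite bA zA rz eq_sym.
- apply: leq_trans (leq_card_setU _ _) _.
  (* Both [b] (by reflexivity) and [c] lie in [Y]. The pairs added to [F] omit [b], whereas those
     known to lie in [S] omit [c]; the counts agree. *)
  have cardY : #|Y :\ b| = #|Y :\ c|.
    have := cardsD1 b Y; rewrite (cardsD1 c Y) !inE bA r_refl cA rbc /=.
    by move/addnI.
  have pb_inj : injective (pair b : T -> T * T) by move=> ? ? [].
  rewrite card_imset // cardY -(card_imset _ pb_inj).
  have disj : [disjoint S :&: setX (A :\ b) (A :\ b) & pair b @: (Y :\ c)].
    rewrite disjoint_subset; apply/subsetP=> -[x y]; rewrite !inE /=.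
    case/and3P=> _ /andP[/eqP xb _] _.
    by apply/imsetP=> -[z _ [/xb]].
  apply: leq_trans (leq_add F'S (leqnn _)) _.
  have [_] := leq_card_setU (S :&: setX (A :\ b) (A :\ b)) (pair b @: (Y :\ c)).
  rewrite disj => /eqP <-.
  apply: subset_leq_card; apply/subsetP=> -[x y]; rewrite !inE /=.
  case/orP=> [/and3P[-> /andP[_ ->] /andP[_ ->]] //|/imsetP[z]].
  rewrite !inE => /and3P[zc zA rz] [-> ->].
  by rewrite Hb // bA zA.
- move=> s sA rsF.
  have sb : s b = b.
    apply/eqP; apply/negPn/negP=> nb; have /andP[rb] := rsF b.
    case/negP; rewrite inE; apply/orP; right; apply: imset_f.
    by rewrite !inE nb rb (perm_closed _ sA) bA.
  apply: F'1.
    apply/subsetP=> x; rewrite !inE => nx.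
    have -> /= : x != b by apply: contraNneq nx => ->; rewrite sb.
    by apply: (subsetP sA); rewrite inE.
  by move=> x; have /andP[-> /=] := rsF x; rewrite inE negb_or => /andP[].
Qed.

End PermutationsInRelation.

(** * Perfect matchings as partner involutions *)

Section PartnerFunctions.

Variables (V : finType) (e : rel V).
Hypothesis e_sym : symmetric e.

Definition matching_of (p : V -> V) : {set {set V}} :=
  [set [set x; p x] | x : V].

Lemma mem_matching_of (p : V -> V) x y : involutive p ->
  ([set x; y] \in matching_of p) = (y == p x).
Proof.
move=> pK; apply/imsetP/eqP=> [[z _ E]|->]; last by exists x.
have : x \in [set z; p z] by rewrite -E set21.
have : y \in [set z; p z] by rewrite -E set22.
have : z \in [set x; y] by rewrite E set21.
have : p z \in [set x; y] by rewrite E set22.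
rewrite !inE => /pred2P[] A /pred2P[] B /pred2P[] C /pred2P[] D;
  by rewrite ?D ?pK; congruence.
Qed.

Lemma edge_set2 x y : ([set x; y] \in edges e) = e x y.
Proof.
rewrite inE; apply/existsP/idP => [[a /existsP[b /andP[eab /eqP E]]]|exy].
  have : x \in [set a; b] by rewrite -E set21.
  have : y \in [set a; b] by rewrite -E set22.
  have : a \in [set x; y] by rewrite E set21.
  have : b \in [set x; y] by rewrite E set22.
  rewrite !inE => /pred2P[] A /pred2P[] B /pred2P[] C /pred2P[] D;
    subst; rewrite // 1?e_sym //; congruence.
by exists x; apply/existsP; exists y; rewrite exy /=.
Qed.

Lemma matching_of_perfect (p : V -> V) :
  involutive p -> (forall x, e x (p x)) -> perfect_matching e (matching_of p).
Proof.
move=> pK ep; apply/andP; split.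
  by apply/subsetP=> _ /imsetP[x _ ->]; rewrite edge_set2.
apply/forallP=> v; apply/cards1P; exists [set v; p v].
apply/setP=> f; rewrite !inE; apply/andP/eqP => [[]|->].
  case/imsetP=> z _ ->; rewrite !inE => /pred2P[->|->] //.
  by rewrite pK setUC.
by rewrite mem_matching_of // eqxx set21.
Qed.

(** Choose for each [v] the other end of an edge of [M] at [v]; uniqueness of that edge makes the
    choice involutive. *)
Lemma perfect_matching_partner (M : {set {set V}}) : perfect_matching e M ->
  exists p, [/\ involutive p, forall x, e x (p x) & M = matching_of p].
Proof.
case/andP=> ME /forallP M1.
have ex v : [exists w, [set v; w] \in M].
  have /cards1P[f Ef] := M1 v.
  have /setIdP[fM vf] : f \in [set f in M | v \in f] by rewrite Ef set11.
  have := subsetP ME f fM; rewrite inE => /existsP[x /existsP[y /andP[_ /eqP fE]]].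
  move: vf; rewrite fE => /set2P[] ->; apply/existsP.
    by exists y; rewrite -fE.
  by exists x; rewrite setUC -fE.
pose p v := xchoose (existsP (ex v)).
have pM v : [set v; p v] \in M by apply: (xchooseP (existsP (ex v))).
have uniqM v f g : f \in M -> g \in M -> v \in f -> v \in g -> f = g.
  move=> fM gM vf vg; have /cards1P[k Ek] := M1 v.
  have : f \in [set f in M | v \in f] by rewrite inE fM.
  have : g \in [set f in M | v \in f] by rewrite inE gM.
  by rewrite Ek => /set1P-> /set1P->.
have ME' : M = matching_of p.
  apply/setP=> f; apply/idP/imsetP=> [fM|[v _ ->] //].
  have [v vf] := edge_neq0 (subsetP ME f fM).
  by exists v => //; apply: (uniqM v); rewrite ?set21.
have pK : involutive p.
  move=> v; have E : [set p v; p (p v)] = [set v; p v].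
    by apply: (uniqM (p v)); rewrite ?set21 ?set22.
  have : v \in [set p v; p (p v)] by rewrite E set21.
  have : p (p v) \in [set v; p v] by rewrite -E set22.
  by rewrite !inE => /pred2P[] A /pred2P[] B; congruence.
by exists p; split=> // x; rewrite -edge_set2; apply: (subsetP ME).
Qed.

Lemma matching_of_inj (p q : V -> V) : involutive p -> involutive q ->
  matching_of p = matching_of q -> p =1 q.
Proof.
move=> pK qK E x; apply/eqP; rewrite -mem_matching_of // -E.
by rewrite mem_matching_of.
Qed.

End PartnerFunctions.

(** * Perfect matchings of a bipartite graph as permutations of one side *)

Section Bipartite.

Variables (V : finType) (e : rel V) (A : {set V}).
Hypotheses (e_sym : symmetric e)
  (e_bip : forall x y, e x y -> (x \in A) != (y \in A)).

Lemma partner_side (p : V -> V) x :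
  (forall x, e x (p x)) -> (p x \in A) = (x \notin A).
Proof. by move/(_ x)/e_bip; case: (x \in A); case: (p x \in A). Qed.

Variable p : V -> V.
Hypotheses (pK : involutive p) (ep : forall x, e x (p x)).

(** The partner function of the matching encoded by [s]; the inverse on the other side makes it an
    involution. *)
Definition perm_partner (s : {perm V}) x :=
  if x \in A then p (s x) else (s^-1)%g (p x).

Lemma perm_partnerK s : perm_on A s -> involutive (perm_partner s).
Proof.
move=> sA x; rewrite /perm_partner; case: (boolP (x \in A)) => xA.
  by rewrite (partner_side _ ep) (perm_closed _ sA) xA /= pK permK.
by rewrite (perm_closed _ (perm_onV sA)) (partner_side _ ep) xA permKV pK.
Qed.

Lemma perm_partner_edge s : perm_on A s -> (forall x, e x (p (s x))) ->
  forall x, e x (perm_partner s x).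
Proof.
move=> sA es x; rewrite /perm_partner; case: ifPn => xA //.
by rewrite e_sym; have := es ((s^-1)%g (p x)); rewrite permKV pK.
Qed.

(** Each edge is read from its end in [A], which removes the branch with the inverse permutation. *)
Lemma mem_perm_matching s f : perm_on A s ->
  reflect (exists2 x, x \in A & f = [set x; p (s x)])
          (f \in matching_of (perm_partner s)).
Proof.
move=> sA; apply: (iffP imsetP) => [[x _ ->]|[x xA ->]]; last first.
  by exists x; rewrite // /perm_partner xA.
rewrite /perm_partner; case: ifPn => xA; first by exists x.
exists ((s^-1)%g (p x)); last by rewrite permKV pK setUC.
by rewrite (perm_closed _ (perm_onV sA)) (partner_side _ ep).
Qed.

(** Both partner functions swap the sides, so [p] after [q] permutes [A]; extend it by the
    identity. *)
Lemma perm_of_partner (q : V -> V) : involutive q -> (forall x, e x (q x)) ->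
  exists2 s : {perm V}, perm_on A s & {in A, forall x, p (s x) = q x}.
Proof.
move=> qK eq_; pose f x := if x \in A then p (q x) else x.
have fA x : (f x \in A) = (x \in A).
  rewrite /f; case: ifPn => [xA|/negPf //].
  by rewrite (partner_side _ ep) (partner_side _ eq_) xA.
have f_inj : injective f.
  move=> x y E; have := congr1 (fun z => z \in A) E; rewrite /= !fA => xy.
  move: E; rewrite /f xy; case: ifP => // _.
  by move/(can_inj pK)/(can_inj qK).
exists (perm f_inj) => [|x xA]; last by rewrite permE /f xA pK.
by apply/subsetP=> x; rewrite inE permE /f; case: ifPn; rewrite ?eqxx.
Qed.

Lemma edge_pair_inj :
  {in setX A A &, injective (fun z : V * V => [set z.1; p z.2])}.
Proof.
move=> [x y] [x' y'] /setXP[/= xA yA] /setXP[/= x'A y'A] E.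
have pyA : p y \notin A by rewrite (partner_side _ ep) yA.
have py'A : p y' \notin A by rewrite (partner_side _ ep) y'A.
have : x \in [set x'; p y'] by rewrite -E set21.
have : p y \in [set x'; p y'] by rewrite -E set22.
case/set2P=> [Epy|/(can_inj pK) ->]; first by rewrite Epy x'A in pyA.
by case/set2P=> [-> //|Ex]; rewrite -Ex xA in py'A.
Qed.

(** A pair [(x, y)] of points of [A] encodes the edge [[set x; p y]], diagonal pairs being the edges
    of the given matching. The anti-forcing set is the image under [ed] of the feedback set for
    [S2], the encoded form of [S]. *)
Lemma af_le_global_forcing (S : {set {set V}}) :
  global_forcing e S -> af e (matching_of p) <= #|S|.
Proof.
case/andP=> SE noS.
have pM := matching_of_perfect e_sym pK ep.
pose r : rel V := [rel x y | e x (p y)].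
pose ed (z : V * V) := [set z.1; p z.2].
pose S2 : {set V * V} := [set z in setX A A | ed z \in S].
(* One inclusion is enough, the hypotheses being symmetric in [s] and [t]. *)
have sub_trace s t : perm_on A s -> perm_on A t ->
    (forall x y, (x, y) \in S2 -> (s x == y) = (t x == y)) ->
    matching_of (perm_partner s) :&: S \subset matching_of (perm_partner t) :&: S.
  move=> sA tA st; apply/subsetP=> f /setIP[/(mem_perm_matching _ sA)[x xA ->] fS].
  rewrite inE fS andbT; apply/(mem_perm_matching _ tA); exists x => //.
  have := st x (s x); rewrite !inE xA (perm_closed _ sA) xA fS eqxx.
  by move/(_ isT)/esym/eqP=> ->.
have gA : globally_forces r S2 A.
  move=> s t sA tA rs rt st.
  have E : matching_of (perm_partner s) = matching_of (perm_partner t).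
    apply/eqP/negPn/negP=> ne; case/negP: noS.
    apply/existsP; exists (matching_of (perm_partner s)).
    apply/existsP; exists (matching_of (perm_partner t)).
    have pms u : perm_on A u -> (forall x, r x (u x)) ->
        perfect_matching e (matching_of (perm_partner u)).
      by move=> uA ru; apply: matching_of_perfect (perm_partnerK uA) (perm_partner_edge uA ru).
    rewrite !pms //= ne eqEsubset !sub_trace //= => x y xy.
    by rewrite st.
  apply/permP=> x; have := matching_of_inj (perm_partnerK sA) (perm_partnerK tA) E x.
  rewrite /perm_partner; case: ifPn => [_ /(can_inj pK) //|xA _].
  by rewrite (out_perm sA) // (out_perm tA).
have [F [FA FS F1]] := feedback_set (fun x => ep x : r x x) gA.
have FAA : F \subset setX A A.
  by apply/subsetP=> -[x y] /FA /and4P[xA yA _ _]; apply/setXP.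
have S2_le : #|S2 :&: setX A A| <= #|S|.
  rewrite -(card_in_imset (f := ed)); last first.
    move=> y z /setIP[_ yA] /setIP[_ zA]; exact: edge_pair_inj.
  apply: subset_leq_card; apply/subsetP=> _ /imsetP[z /setIP[zS _] ->].
  by move: zS; rewrite inE => /andP[].
apply: leq_trans S2_le; apply: leq_trans FS.
apply: leq_trans (leq_imset_card ed (mem F)).
have [_ af_min] := afP pM; apply: af_min; apply/andP; split.
  apply/subsetP=> _ /imsetP[[x y] /FA /and4P[xA yA rxy nxy] ->].
  rewrite inE edge_set2 // mem_matching_of //= [e _ _]rxy andbT.
  by apply: contra nxy => /eqP/(can_inj pK) ->.
have dsym : symmetric (del_edges e (ed @: F)).
  by move=> x y; rewrite /del_edges /= e_sym setUC.
apply/cards1P; exists (matching_of p); apply/setP=> N; rewrite !inE.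
apply/idP/eqP=> [/(perfect_matching_partner dsym)[q [qK eq_ ->]]|->].
  have eq1 x : e x (q x) by have /andP[] := eq_ x.
  have [s sA sq] := perm_of_partner qK eq1.
  (* On [A], an edge surviving the deletion gives a pair outside [F]; off [A], [s] is the identity
     and [F] has no pair. *)
  have s1 : s = 1%g.
    apply: F1 => // x; case: (boolP (x \in A)) => xA.
      rewrite /r /= sq // eq1 /=; have /andP[_] := eq_ x; rewrite -sq //.
      by apply: contra => xF; apply/imsetP; exists (x, s x).
    rewrite /r (out_perm sA) //= ep /=.
    by apply: contra xA => /FA /and4P[].
  apply: eq_imset => x; case: (boolP (x \in A)) => xA.
    by rewrite -sq // s1 perm1.
  have qA : q x \in A by rewrite (partner_side _ eq1).
  by have := sq _ qA; rewrite s1 perm1 qK => /(congr1 p); rewrite pK => ->.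
apply: matching_of_perfect => // x; rewrite /del_edges /= ep /=.
(* The given matching survives: a deleted edge in it would come from a diagonal pair, and [F] has
   none. *)
apply/imsetP=> -[[y z] /FA /and4P[_ _ _ /eqP yz]] E; case: yz.
have : [set y; p z] \in matching_of p.
  by rewrite -[[set y; p z]]E mem_matching_of.
by rewrite mem_matching_of // => /eqP/(can_inj pK).
Qed.

End Bipartite.

Theorem theorem3p3 (V : finType) (e : rel V)
  (e_sym : symmetric e) (e_irr : irreflexive e)
  (e_bip : bipartite e)
  (e_pm : exists M : {set {set V}}, perfect_matching e M) :
  gf e >= Af e.
Proof.
have [A Abip] := e_bip.
have [[S gS <-] _] := gfP e.
apply/bigmax_leqP=> M /(perfect_matching_partner e_sym)[p [pK ep ->]].
exact: (af_le_global_forcing e_sym Abip pK ep gS).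
Qed.
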